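(* The emptiness problem is decidable for effective generalized pushdown automata: there is a procedure which, given an effective GPA $\mathcal{P}$ (with access to the decision procedures witnessing its effectiveness), decides whether $L(\mathcal{P})=\emptyset$.
   Context: For a finite alphabet $X$, $X_\epsilon = X\cup\{\epsilon\}$. A finite state automaton (FSA) over $\Gamma$ is a standard nondeterministic finite automaton (with $\epsilon$-transitions allowed) with language $L(\cdot)$. A generalized pushdown automaton (GPA) is a tuple $\mathcal{P}=(P,\Sigma,\Gamma,\delta,p_0,\gamma_0,F)$ where $P$ is a finite nonempty set of states, $\Sigma$ an input alphabet, $\Gamma$ a stack alphabet, $\delta: P\times\Gamma\times\Sigma_\epsilon\times P\to 2^{\Gamma^*}$ assigns to each tuple a (possibly infinite) language over $\Gamma$, $p_0\in P$ the initial state, $\gamma_0\in\Gamma$ the initial stack symbol, $F\subseteq P$ the final states. Configurations are pairs $(p,w)\in P\times\Gamma^*$; there is a step $(p,\gamma w)\xrightarrow{a}(p',uw)$ whenever $u\in\delta(p,\gamma,a,p')$ and $w\in\Gamma^*$. The language $L(\mathcal{P})$ is the set of words $\tau\in\Sigma^*$ such that $(p_0,\gamma_0)$ reaches some configuration $(p,\epsilon)$ with $p\in F$ by a finite sequence of steps whose concatenated labels equal $\tau$. $\mathcal{P}$ is effective if for every FSA $\mathcal{B}$ over $\Gamma$ it is decidable whether $L(\mathcal{B})\cap\delta(p,\gamma,a,p')\neq\emptyset$, for all $p,p'\in P$, $\gamma\in\Gamma$, $a\in\Sigma_\epsilon$. *)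

(* Defs.v *)
From mathcomp Require Import all_boot.

Set Implicit Arguments.
Unset Strict Implicit.
Unset Printing Implicit Defensive.

(* Decidability is stated in an explicit model of computation, because with
   the classical axioms every problem has a deciding Rocq function: Kleene's
   mu-recursive functions on tuples of natural numbers, extended with an
   instruction [Call] that runs a subroutine on the current arguments.
   Arities are left implicit: a program acts on argument lists. *)
Inductive prog : Type :=
| Zero
| Succ
| Proj of nat
| Comp of prog & seq prog
| PrimRec of prog & prog
| Mu of prog
| Call.

(* [eval S f v y]: with [S] as the input/output graph of the subroutine,
   [f] halts on arguments [v] with result [y]. *)
Inductive eval (S : seq nat -> nat -> Prop) : prog -> seq nat -> nat -> Prop :=
| EvalZero v : eval S Zero v 0
| EvalSucc x v : eval S Succ (x :: v) x.+1
| EvalProj i v : i < size v -> eval S (Proj i) v (nth 0 v i)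
| EvalComp f gs v w y :
    eval_all S gs v w -> eval S f w y -> eval S (Comp f gs) v y
| EvalPrimRec0 f g v y : eval S f v y -> eval S (PrimRec f g) (0 :: v) y
| EvalPrimRecS f g n v z y :
    eval S (PrimRec f g) (n :: v) z -> eval S g [:: n, z & v] y ->
    eval S (PrimRec f g) (n.+1 :: v) y
| EvalMu f v n (k : nat -> nat) :
    (forall i, i < n -> eval S f (i :: v) (k i).+1) ->
    eval S f (n :: v) 0 -> eval S (Mu f) v n
| EvalCall v y : S v y -> eval S Call v y
with eval_all (S : seq nat -> nat -> Prop) :
    seq prog -> seq nat -> seq nat -> Prop :=
| EvalNil v : eval_all S [::] v [::]
| EvalCons g gs v y w :
    eval S g v y -> eval_all S gs v w -> eval_all S (g :: gs) v (y :: w).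

(* Without a subroutine, [Call] never returns and [prog] is the ordinary class
   of partial recursive functions. *)
Definition computes : prog -> seq nat -> nat -> Prop := eval (fun _ _ => False).

Definition computes_calling (d : prog) : prog -> seq nat -> nat -> Prop :=
  eval (computes d).

(* The program with behaviour [run] halts on [v] with the truth value of [A]. *)
Definition answers (run : seq nat -> nat -> Prop) (v : seq nat) (A : Prop) :=
  exists b : bool, run v b /\ (b <-> A).

(* In automata, [None : option A] is the empty word epsilon. *)
Record fsa (A : finType) := Fsa {
  fsa_state : finType;
  fsa_trans : fsa_state -> option A -> fsa_state -> bool;
  fsa_init : fsa_state;
  fsa_final : {set fsa_state}
}.

Inductive fsa_run (A : finType) (B : fsa A) :
    fsa_state B -> seq A -> fsa_state B -> Prop :=
| FsaRefl q : fsa_run q [::] q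
| FsaStep q x q' w q'' :
    fsa_trans q x q' -> fsa_run q' w q'' -> fsa_run q (seq_of_opt x ++ w) q''.

Definition fsa_lang (A : finType) (B : fsa A) (w : seq A) : Prop :=
  exists2 q, q \in fsa_final B & fsa_run (fsa_init B) w q.

Record gpa (P Sigma Gamma : finType) := Gpa {
  gpa_delta : P -> Gamma -> option Sigma -> P -> seq Gamma -> Prop;
  gpa_init : P;
  gpa_stack0 : Gamma;
  gpa_final : {set P}
}.

Section Gpa.
Variables (P Sigma Gamma : finType) (G : gpa P Sigma Gamma).

Inductive gpa_step : P * seq Gamma -> option Sigma -> P * seq Gamma -> Prop :=
| GpaStep p g a p' u w :
    gpa_delta G p g a p' u -> gpa_step (p, g :: w) a (p', u ++ w).

Inductive gpa_run : P * seq Gamma -> seq Sigma -> P * seq Gamma -> Prop :=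
| GpaRefl c : gpa_run c [::] c
| GpaTrans c a c' t c'' :
    gpa_step c a c' -> gpa_run c' t c'' -> gpa_run c (seq_of_opt a ++ t) c''.

Definition gpa_lang (t : seq Sigma) : Prop :=
  exists2 p, p \in gpa_final G &
    gpa_run (gpa_init G, [:: gpa_stack0 G]) t (p, [::]).

End Gpa.

(* Encodings. Elements of a finite type are coded by their rank in its
   enumeration, epsilon by 0 and the letter of rank [i] by [i.+1], finite lists
   by the bijection [CodeSeq.code], and predicates by their truth tables. *)
Definition letter_code (A : finType) (x : option A) : nat :=
  if x is Some a then (enum_rank a).+1 else 0.

Definition set_code (T : finType) (X : {set T}) : nat :=
  CodeSeq.code [seq nat_of_bool (x \in X) | x <- enum T].

Definition trans_code (A : finType) (B : fsa A) : nat :=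
  CodeSeq.code [seq
    CodeSeq.code [seq
      CodeSeq.code [seq nat_of_bool (fsa_trans q x q')
                   | q' <- enum (fsa_state B)]
    | x <- None :: [seq Some a | a <- enum A]]
  | q <- enum (fsa_state B)].

Definition fsa_code (A : finType) (B : fsa A) : nat :=
  CodeSeq.code [:: #|fsa_state B|; trans_code B;
                   nat_of_ord (enum_rank (fsa_init B)); set_code (fsa_final B)].

(* The transition languages are not part of the input: they may be infinite
   and are accessible only through the decision procedure of [effective_by]. *)
Definition gpa_input (P Sigma Gamma : finType) (G : gpa P Sigma Gamma) :
    seq nat :=
  [:: #|P|; #|Sigma|; #|Gamma|; nat_of_ord (enum_rank (gpa_init G));
      nat_of_ord (enum_rank (gpa_stack0 G)); set_code (gpa_final G)].

Definition query (P Sigma Gamma : finType) (p : P) (g : Gamma)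
    (a : option Sigma) (p' : P) (B : fsa Gamma) : seq nat :=
  [:: nat_of_ord (enum_rank p); nat_of_ord (enum_rank g); letter_code a;
      nat_of_ord (enum_rank p'); fsa_code B].

(* [d] is a decision procedure witnessing that [G] is effective. *)
Definition effective_by (P Sigma Gamma : finType) (G : gpa P Sigma Gamma)
    (d : prog) : Prop :=
  forall (p : P) (g : Gamma) (a : option Sigma) (p' : P) (B : fsa Gamma),
    answers (computes d) (query p g a p' B)
      (exists u, fsa_lang B u /\ gpa_delta G p g a p' u).

(* Main.v *)
Require Import Defs.
From mathcomp Require Import all_boot.
From Stdlib Require Import ClassicalEpsilon FunctionalExtensionality.

Set Implicit Arguments.
Unset Strict Implicit.
Unset Printing Implicit Defensive.

(** A GPA has empty language iff some set of triples [(p, g, p')] contains no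
    triple [(p0, gamma0, f)] with [f] final and is closed under the following
    rule: regard the set as an automaton with states [P], an edge labelled [g]
    from [p] to [p'] for each triple; if for some [a] and [p1] it accepts, from
    [p1] to [p'], some word of [delta (p, g, a, p1)], then [(p, g, p')] belongs
    to the set.  The set of triples such that the GPA can go from [p] to [p']
    while popping [g] is closed, and every closed set contains it.  Closedness
    is a finite conjunction of effectiveness queries, so emptiness is decided
    by trying all sets of triples; no saturation is needed. *)

(** [isT] proves the bound [i < size v] because the length of an explicit argument list computes
    even when its entries are variables. *)
Ltac proj := match goal with |- eval _ (Proj ?i) ?v _ =>
  exact: (@EvalProj _ i v isT) end.

Lemma letter_code_lt (A : finType) (x : option A) : letter_code x < #|A|.+1.
Proof. by case: x => [a|] //=; rewrite ltnS ltn_ord. Qed.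

(** * Programs for arithmetic and binary digits *)

Section Programs.
Variable S : seq nat -> nat -> Prop.
Implicit Types (f g : prog) (v : seq nat).

Lemma eval_comp1 f g v x y :
  eval S g v x -> eval S f [:: x] y -> eval S (Comp f [:: g]) v y.
Proof. by move=> gx; apply: EvalComp; do !constructor. Qed.

Lemma eval_comp2 f g1 g2 v x1 x2 y :
  eval S g1 v x1 -> eval S g2 v x2 -> eval S f [:: x1; x2] y ->
  eval S (Comp f [:: g1; g2]) v y.
Proof. by move=> g1x g2x; apply: EvalComp; do !constructor. Qed.

Lemma eval_PrimRec f g n v (h : nat -> nat) :
  eval S f v (h 0) ->
  (forall i, i < n -> eval S g [:: i, h i & v] (h i.+1)) ->
  eval S (PrimRec f g) (n :: v) (h n).
Proof.
move=> f0; elim: n => [|n IHn] gS; first exact: EvalPrimRec0.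
apply: EvalPrimRecS (gS n _) => //.
by apply: IHn => i lt_in; apply/gS/ltnW.
Qed.

(** Since [Comp] replaces the whole argument list, arguments to be kept are passed on one by one;
    [k] is explicit because programs carry no arity. *)
Definition projs j k := [seq Proj i | i <- iota j k].

Lemma eval_projs u v : eval_all S (projs (size u) (size v)) (u ++ v) v.
Proof.
elim: v u => [|x v IHv] u /=; first exact: EvalNil.
apply: EvalCons; last by rewrite -cat_rcons -(size_rcons u x); apply: IHv.
have /(EvalProj S) : size u < size (u ++ x :: v).
  by rewrite size_cat /= addnS ltnS leq_addr.
by rewrite nth_cat ltnn subnn.
Qed.

Definition OneE := Comp Succ [:: Zero].

Lemma eval_one v : eval S OneE v 1.
Proof. by apply: eval_comp1; constructor. Qed.

Definition SuccE f := Comp Succ [:: f].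

Lemma eval_succ f v x : eval S f v x -> eval S (SuccE f) v x.+1.
Proof. by move=> fx; apply: eval_comp1 fx _; constructor. Qed.

Definition AddE f g := Comp (PrimRec (Proj 0) (SuccE (Proj 1))) [:: f; g].

Lemma eval_add f g v x y :
  eval S f v x -> eval S g v y -> eval S (AddE f g) v (x + y).
Proof.
move=> fx gy; apply: eval_comp2 fx gy _.
apply: (@eval_PrimRec _ _ _ _ (addn^~ y)) => [|i _]; first by proj.
by apply: eval_succ; proj.
Qed.

Definition MulE f g := Comp (PrimRec Zero (AddE (Proj 2) (Proj 1))) [:: f; g].

Lemma eval_mul f g v x y :
  eval S f v x -> eval S g v y -> eval S (MulE f g) v (x * y).
Proof.
move=> fx gy; apply: eval_comp2 fx gy _.
apply: (@eval_PrimRec _ _ _ _ (muln^~ y)) => [|i _]; first by constructor.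
by apply: eval_add; proj.
Qed.

Definition PredE f := Comp (PrimRec Zero (Proj 0)) [:: f].

Lemma eval_pred f v x : eval S f v x -> eval S (PredE f) v x.-1.
Proof.
move=> fx; apply: eval_comp1 fx _.
by apply: (@eval_PrimRec _ _ _ _ predn) => [|i _]; [constructor | proj].
Qed.

Definition SubE f g := Comp (PrimRec (Proj 0) (PredE (Proj 1))) [:: g; f].

Lemma eval_sub f g v x y :
  eval S f v x -> eval S g v y -> eval S (SubE f g) v (x - y).
Proof.
move=> fx gy; apply: eval_comp2 gy fx _.
apply: (@eval_PrimRec _ _ _ _ (subn x)) => [|i _]; first by rewrite subn0; proj.
by rewrite subnS; apply: eval_pred; proj.
Qed.

Definition Pow2E f := Comp (PrimRec OneE (AddE (Proj 1) (Proj 1))) [:: f].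

Lemma eval_pow2 f v x : eval S f v x -> eval S (Pow2E f) v (2 ^ x).
Proof.
move=> fx; apply: eval_comp1 fx _.
apply: (@eval_PrimRec _ _ _ _ (expn 2)) => [|i _]; first exact: eval_one.
by rewrite expnS mul2n -addnn; apply: eval_add; proj.
Qed.

(** For halves rounded down, half of [i.+1] is [i] minus half of [i], so the recursion needs only
    the previous value. *)
Definition HalfE f := Comp (PrimRec Zero (SubE (Proj 0) (Proj 1))) [:: f].

Lemma eval_half f v x : eval S f v x -> eval S (HalfE f) v x./2.
Proof.
move=> fx; apply: eval_comp1 fx _.
apply: (@eval_PrimRec _ _ _ _ half) => [|i _]; first by constructor.
have ->: i.+1./2 = i - i./2.
  by rewrite -{2}(odd_double_half i) -addnn addnA addnK /= uphalf_half.
by apply: eval_sub; proj.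
Qed.

Definition NotE f := SubE OneE f.

Lemma eval_not f v (b : bool) : eval S f v b -> eval S (NotE f) v (~~ b).
Proof.
move=> fb; have -> : ~~ b = 1 - b :> nat by case: b {fb}.
exact: eval_sub (eval_one v) fb.
Qed.

Definition OddE f := Comp (PrimRec Zero (NotE (Proj 1))) [:: f].

Lemma eval_odd f v x : eval S f v x -> eval S (OddE f) v (odd x).
Proof.
move=> fx; apply: eval_comp1 fx _.
apply: (@eval_PrimRec _ _ _ _ (fun i => odd i : nat)) => [|i _].
  by constructor.
by apply: eval_not; proj.
Qed.

(* Finite sets are coded by the binary digits of a number. *)
Definition bit T i := odd (iter i half T).

Definition BitE f g :=
  OddE (Comp (PrimRec (Proj 0) (HalfE (Proj 1))) [:: g; f]).

Lemma eval_bit f g v T i :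
  eval S f v T -> eval S g v i -> eval S (BitE f g) v (bit T i).
Proof.
move=> fT gi; apply/eval_odd/(eval_comp2 gi fT).
apply: (@eval_PrimRec _ _ _ _ (fun i => iter i half T)) => [|k _].
  by proj.
by apply: eval_half; proj.
Qed.

Definition IsZeroE f := NotE (Comp (PrimRec Zero OneE) [:: f]).

Lemma eval_iszero f v x : eval S f v x -> eval S (IsZeroE f) v (x == 0).
Proof.
move=> fx; rewrite -[x == 0]negbK; apply/eval_not/(eval_comp1 fx).
apply: (@eval_PrimRec _ _ _ _ (fun i => (i != 0) : nat)) => [|i _].
  by constructor.
exact: eval_one.
Qed.

Definition EqE f g := IsZeroE (AddE (SubE f g) (SubE g f)).

Lemma eval_eq f g v x y :
  eval S f v x -> eval S g v y -> eval S (EqE f g) v (x == y).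
Proof.
move=> fx gy; rewrite eqn_leq -!subn_eq0 -addn_eq0.
by apply: eval_iszero; apply: eval_add; apply: eval_sub.
Qed.

(** * Programs building coded lists *)

(** [CodeSeq.code] sends the empty list to 0 and [x :: s] to [2 ^ x * (2 * code s + 1)]. *)
Definition ConsE f g := MulE (Pow2E f) (SuccE (AddE g g)).

Lemma eval_cons f g v x s :
  eval S f v x -> eval S g v (CodeSeq.code s) ->
  eval S (ConsE f g) v (CodeSeq.code (x :: s)).
Proof.
move=> fx gs; apply: eval_mul; first exact: eval_pow2.
by rewrite -addnn; apply/eval_succ/eval_add.
Qed.

(** [bnd] is supplied twice: as the loop counter, and as a parameter from which the body recovers
    the index of the entry to prepend. *)
Definition TabE k bnd f :=
  Comp (PrimRec Zero (ConsE
      (Comp f (SubE (PredE (Proj 2)) (Proj 0) :: projs 3 k)) (Proj 1)))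
    [:: bnd, bnd & projs 0 k].

(* The list is built from its last entry, so step [i] prepends entry [n - i - 1]. *)
Lemma eval_tab bnd f v n (h : nat -> nat) :
  eval S bnd v n -> (forall i, i < n -> eval S f (i :: v) (h i)) ->
  eval S (TabE (size v) bnd f) v (CodeSeq.code (mkseq h n)).
Proof.
move=> bn fh; apply: EvalComp.
  by do 2!apply: (EvalCons bn); apply: (eval_projs [::] v).
(* Invariant: after [k] rounds the accumulator codes the last [k] entries. *)
have := @eval_PrimRec Zero (ConsE
      (Comp f (SubE (PredE (Proj 2)) (Proj 0) :: projs 3 (size v))) (Proj 1))
   n (n :: v) (fun k => CodeSeq.code (drop (n - k) (mkseq h n))).
rewrite subnn drop0; apply=> [|i lt_in].
  by rewrite subn0 drop_oversize ?size_mkseq //; constructor.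
have lt_jn : n - i.+1 < n by rewrite -subSn // subSS leq_subr.
rewrite (@drop_nth _ 0 (n - i.+1)) ?size_mkseq // nth_mkseq // -subSn // subSS.
apply: eval_cons; last by proj.
apply: EvalComp (fh _ lt_jn); apply: EvalCons.
  have ->: n - i.+1 = n.-1 - i by rewrite -subn1 -subnDA add1n.
  by apply: eval_sub; [apply: eval_pred|]; proj.
exact: (eval_projs [:: i; _; n]).
Qed.

(** * Decision programs: connectives and bounded quantifiers *)

Definition decides f v A := answers (eval S f) v A.

Lemma decides_bool f v (b : bool) (A : Prop) :
  eval S f v b -> (b <-> A) -> decides f v A.
Proof. by move=> fb bA; exists b. Qed.

Lemma decides_eq f g v x y :
  eval S f v x -> eval S g v y -> decides (EqE f g) v (x = y).
Proof.
by move=> fx gy; exists (x == y); split; [apply: eval_eq | split=> /eqP].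
Qed.

Lemma decides_iff f v (A B : Prop) : decides f v A -> (A <-> B) -> decides f v B.
Proof. by move=> [b [fb bA]] AB; exists b; split=> //; apply: iff_trans AB. Qed.

Lemma decides_not f v A : decides f v A -> decides (NotE f) v (~ A).
Proof.
move=> [b [fb bA]]; exists (~~ b); split; first exact: eval_not.
by rewrite -bA; split=> /negP.
Qed.

Definition AndE f g := MulE f g.

Lemma decides_and f g v A B :
  decides f v A -> decides g v B -> decides (AndE f g) v (A /\ B).
Proof.
move=> [b [fb bA]] [c [gc cB]]; exists (b && c).
split; first by rewrite -mulnb; apply: eval_mul.
by rewrite -bA -cB; split=> /andP.
Qed.

Definition ImpE f g := NotE (AndE f (NotE g)).

Lemma decides_imp f g v (A B : Prop) :
  decides f v A -> decides g v B -> decides (ImpE f g) v (A -> B).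
Proof.
move=> fA gB.
apply: (decides_iff (decides_not (decides_and fA (decides_not gB)))).
(* Replacing [B] by its computed truth value makes the double negation removable without a classical
   axiom. *)
have [b [_ <-]] := gB.
split=> [nAB Aa|AB [Aa nB]]; last exact/nB/AB.
by apply: contraT => /negP nb; case: nAB.
Qed.

(** The accumulator holds the conjunction so far and is hidden from [f], which sees the index
    followed by the [k] original arguments. *)
Definition AllE k bnd f :=
  Comp (PrimRec OneE (AndE (Comp f (Proj 0 :: projs 2 k)) (Proj 1)))
    (bnd :: projs 0 k).

Lemma decides_all bnd f v n (A : nat -> Prop) :
  eval S bnd v n -> (forall i, i < n -> decides f (i :: v) (A i)) ->
  decides (AllE (size v) bnd f) v (forall i, i < n -> A i).
Proof.
set loop := PrimRec OneE (AndE (Comp f (Proj 0 :: projs 2 (size v))) (Proj 1)).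
move=> bn fA.
suff [b [loopb bA]] : decides loop (n :: v) (forall i, i < n -> A i).
  exists b; split=> //; apply: EvalComp loopb.
  by apply: (EvalCons bn); apply: (eval_projs [::] v).
elim: n fA {bn} => [|n IHn] fA.
  by apply: (@decides_bool _ _ true); first exact/EvalPrimRec0/eval_one.
have [i lt_in|b [loopb bA]] := IHn; first exact/fA/ltnW.
have [c [fc cA]] := fA n (ltnSn n).
exists (c && b); split.
  apply: EvalPrimRecS loopb _; rewrite -mulnb; apply: eval_mul; last by proj.
  apply: EvalComp fc; apply: EvalCons; first by proj.
  exact: (eval_projs [:: n; nat_of_bool b]).
split=> [/andP[/cA An /bA Ab] i|AS].
  by rewrite ltnS leq_eqVlt => /predU1P[->|/Ab].
by apply/andP; split; [apply/cA/AS | apply/bA => i /ltnW/AS].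
Qed.

Lemma decides_all_coded (X : Type) (c : X -> nat) bnd f v n (A : X -> Prop) :
    injective c -> (forall x, c x < n) -> (forall i, i < n -> exists x, c x = i) ->
  eval S bnd v n -> (forall x, decides f (c x :: v) (A x)) ->
  decides (AllE (size v) bnd f) v (forall x, A x).
Proof.
move=> c_inj c_lt c_surj bn fA.
apply: (decides_iff (@decides_all _ _ _ n (fun i => forall x, c x = i -> A x) bn _)).
  move=> i /c_surj[x <-]; apply: (decides_iff (fA x)).
  by split=> [Ax y /c_inj->|]; last exact.
by split=> [AS x|AS i _ x _]; [apply: AS (c_lt x) _ erefl | apply: AS].
Qed.

Lemma decides_all_fin (T : finType) bnd f v (A : T -> Prop) :
  eval S bnd v #|T| ->
  (forall x : T, decides f (nat_of_ord (enum_rank x) :: v) (A x)) ->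
  decides (AllE (size v) bnd f) v (forall x, A x).
Proof.
apply: decides_all_coded => [x y /val_inj/enum_rank_inj //|x|i lt_i].
  exact: ltn_ord.
by exists (enum_val (Ordinal lt_i)); rewrite enum_valK.
Qed.

Lemma decides_all_letter (T : finType) bnd f v (A : option T -> Prop) :
  eval S bnd v #|T|.+1 ->
  (forall x : option T, decides f (letter_code x :: v) (A x)) ->
  decides (AllE (size v) bnd f) v (forall x, A x).
Proof.
apply: decides_all_coded.
- by move=> [x|] [y|] //= [] /val_inj/enum_rank_inj ->.
- exact: letter_code_lt.
move=> [|i]; first by exists None.
rewrite ltnS => lt_i; exists (Some (enum_val (Ordinal lt_i))).
by rewrite /= enum_valK.
Qed.

End Programs.

(** * Enumerations, and tables as numbers *)

(** Brings the encodings, which are lists over an enumeration, to the [mkseq] form that [eval_tab]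
    produces. *)
Lemma map_enum_rank (A : Type) (T : finType) (h : nat -> A) :
  [seq h (enum_rank x) | x <- enum T] = mkseq h #|T|.
Proof.
apply: (@eq_from_nth _ (h 0)); rewrite size_map -cardE ?size_mkseq // => i lt_i.
have x0 := enum_val (Ordinal lt_i).
rewrite (nth_map x0) -?cardE // nth_mkseq //.
by rewrite -[i]/(val (Ordinal lt_i)) -enum_val_nth enum_valK.
Qed.

Lemma nth_letter_code (A : finType) (x : option A) :
  nth None (None :: [seq Some a | a <- enum A]) (letter_code x) = x.
Proof.
by case: x => //= a; rewrite (nth_map a) ?nth_enum_rank // -cardE ltn_ord.
Qed.

Lemma map_letter_code (B : Type) (A : finType) (h : nat -> B) :
  [seq h (letter_code x) | x <- None :: [seq Some a | a <- enum A]] =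
  mkseq h #|A|.+1.
Proof.
rewrite /= -map_comp (map_enum_rank _ (h \o succn)) /mkseq /= -[1]/(1 + 0) iotaDl.
by rewrite -map_comp.
Qed.

Lemma bit_surj n (h : nat -> bool) :
  exists2 T, T < 2 ^ n & forall i, i < n -> bit T i = h i.
Proof.
elim: n h => [|n IHn] h; first by exists 0.
(* [h 0] becomes the lowest digit; the shifted function gives the others. *)
have [T ltT bitT] := IHn (h \o succn); exists (h 0 + T.*2).
  by rewrite expnS mul2n -ltn_half_double half_bit_double.
move=> [|i] lt_in; first by rewrite /bit /= oddD odd_double addbF oddb.
by rewrite /bit iterSr half_bit_double; apply: bitT.
Qed.

(** Row-major position in an [n] by [m.+1] by [n] array; the extra letter is epsilon. *)
Definition entry n m T q x q' := bit T ((q * m.+1 + x) * n + q').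

Lemma entry_surj n m (h : nat -> nat -> nat -> bool) :
  exists2 T, T < 2 ^ (n * m.+1 * n) &
    forall q x q', q < n -> x < m.+1 -> q' < n -> entry n m T q x q' = h q x q'.
Proof.
(* Quotients and remainders invert the row-major index. *)
have [T ltT bitT] := bit_surj (n * m.+1 * n)
  (fun i => h (i %/ n %/ m.+1) (i %/ n %% m.+1) (i %% n)).
exists T => // q x q' ltq ltx ltq'; have n_gt0 := leq_ltn_trans (leq0n q) ltq.
have idx_lt a b k l : a < k -> b < l -> a * l + b < k * l.
  move=> ltak ltbl; apply: leq_trans (_ : a.+1 * l <= _).
    by rewrite mulSn addnC ltn_add2r.
  by rewrite leq_mul2r ltak orbT.
rewrite /entry bitT; last by apply: (idx_lt _ _ (n * m.+1)) => //; apply: idx_lt.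
by rewrite divnMDl // modnMDl (divn_small ltq') addn0 divnMDl // modnMDl divn_small //
  !modn_small // addn0.
Qed.

Definition EntryE T q x q' n m :=
  BitE T (AddE (MulE (AddE (MulE q (SuccE m)) x) n) q').

Lemma eval_entry S v T q x q' n m vT vq vx vq' vn vm :
  eval S T v vT -> eval S q v vq -> eval S x v vx -> eval S q' v vq' ->
  eval S n v vn -> eval S m v vm ->
  eval S (EntryE T q x q' n m) v (entry vn vm vT vq vx vq').
Proof.
move=> *; apply: eval_bit => //; apply: eval_add => //; apply: eval_mul => //.
by apply: eval_add => //; apply: eval_mul => //; apply: eval_succ.
Qed.

(** * Runs of finite automata *)

Section Automata.
Variable A : finType.

(** Serves, with the identity map, to change the initial and final states of a table automaton,
    since a run is indexed by the whole automaton. *)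
Lemma fsa_run_graph (B C : fsa A) (h : fsa_state B -> fsa_state C) :
    (forall q x q', fsa_trans q x q' -> fsa_trans (h q) x (h q')) ->
  forall q w q', fsa_run q w q' -> fsa_run (h q) w (h q').
Proof.
move=> hP q w q'; elim=> [q0|q1 x q2 u q3 tr _ IH]; first exact: FsaRefl.
exact: FsaStep (hP _ _ _ tr) IH.
Qed.

Lemma fsa_run_split (B : fsa A) (q q' : fsa_state B) u w :
  fsa_run q (u ++ w) q' -> exists2 q1, fsa_run q u q1 & fsa_run q1 w q'.
Proof.
move Ez: (u ++ w) => z run.
elim: run u Ez => [q0|q1 x q2 z' q3 tr run IH] u.
  by case: u => //= ->; exists q0; exact: FsaRefl.
(* An epsilon step is assigned to the run on [u]. *)
case: x tr => [a|] /= tr; last first.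
  by case/IH=> q4 ru rw; exists q4 => //; apply: FsaStep tr ru.
case: u => [|b u] /= => [Ew|[-> /IH[q4 ru rw]]].
  by exists q1; [exact: FsaRefl | rewrite Ew; apply: FsaStep tr run].
by exists q4 => //; apply: FsaStep tr ru.
Qed.

End Automata.

(** * Closed tables and emptiness *)

Section Gpa.
Variables (P Sigma Gamma : finType) (G : gpa P Sigma Gamma).

Definition table_fsa (tr : P -> option Gamma -> P -> bool) p p' :=
  Fsa tr p [set p'].

Lemma table_fsa_lang tr p p' w :
  fsa_lang (table_fsa tr p p') w <-> @fsa_run _ (table_fsa tr p p') p w p'.
Proof.
split=> [[q /set1P-> //]|run]; exists p' => //.
exact: set11.
Qed.

Definition closed_table (tr : P -> option Gamma -> P -> bool) :=
  forall p g a p1 p',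
    (exists u, fsa_lang (table_fsa tr p1 p') u /\ gpa_delta G p g a p1 u) ->
    tr p (Some g) p'.

(** Induction on the run: if its first step replaces [g] by [u], the automaton path for the new
    stack splits after [u], and closedness contracts the part reading [u] to one edge labelled
    [g]. *)
Lemma closed_table_run tr c t c' p0 p0' : closed_table tr -> gpa_run G c t c' ->
  c'.2 = [::] -> @fsa_run _ (table_fsa tr p0 p0') c.1 c.2 c'.1.
Proof.
move=> tr_closed; elim=> {c t c'} [[p w] /= ->|c a c1 t c' st _ IH /IH {}IH].
  exact: FsaRefl.
case: st IH => p g b p1 u w u_delta /= /fsa_run_split[q run_u run_w].
apply: (@FsaStep _ (table_fsa _ _ _) _ (Some g) q) run_w.
apply: tr_closed; exists u; split; last exact: u_delta.
by apply/table_fsa_lang; apply: fsa_run_graph run_u.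
Qed.

Lemma gpa_run_trans c t c' t' c'' :
  gpa_run G c t c' -> gpa_run G c' t' c'' -> gpa_run G c (t ++ t') c''.
Proof.
by move=> run1 run2; elim: run1 run2 => [//|c0 a c1 t1 c2 st _ IH] /IH;
  rewrite -catA; apply: GpaTrans.
Qed.

Lemma gpa_run_stack c t c' z : gpa_run G c t c' ->
  gpa_run G (c.1, c.2 ++ z) t (c'.1, c'.2 ++ z).
Proof.
elim=> [c0|c0 a c1 t1 c2 st _ IH]; first exact: GpaRefl.
apply: GpaTrans IH; case: st => p g b p1 u w u_delta /=.
by rewrite -catA; constructor.
Qed.

(* [pops p None p'] is false because only triples with a letter are needed;
   arbitrary tables may have epsilon-edges, which can only enlarge the languages
   in [closed_table]. *)
Definition pops p (x : option Gamma) p' :=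
  if x is Some g then exists t, gpa_run G (p, [:: g]) t (p', [::]) else False.

(** Obtained classically: no program computes this table, only its existence matters. *)
Definition popsb p x p' : bool := excluded_middle_informative (pops p x p').

Lemma popsP p x p' : reflect (pops p x p') (popsb p x p').
Proof. exact: sumboolP. Qed.

Lemma popsb_run q0 q0' p w p' : @fsa_run _ (table_fsa popsb q0 q0') p w p' ->
  exists t, gpa_run G (p, w) t (p', [::]).
Proof.
elim=> {p w p'} [p|p x p1 w p' /popsP pop _ [t' run]].
  by exists [::]; exact: GpaRefl.
case: x pop => // g [t pop]; exists (t ++ t').
exact: gpa_run_trans (gpa_run_stack w pop) run.
Qed.

Lemma popsb_closed : closed_table popsb.
Proof.
move=> p g a p1 p' [u [/table_fsa_lang/popsb_run[t run] u_delta]].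
apply/popsP; exists (seq_of_opt a ++ t); apply: GpaTrans run.
by rewrite -[u]cats0; constructor.
Qed.

Definition separates (tr : P -> option Gamma -> P -> bool) :=
  closed_table tr /\
  forall p, p \in gpa_final G -> ~ tr (gpa_init G) (Some (gpa_stack0 G)) p.

Lemma separates_empty tr : separates tr -> forall t, ~ gpa_lang G t.
Proof.
move=> [tr_closed tr_final] t [p /tr_final tr'p run].
(* Applied to the whole run, [closed_table_run] would give only a path, perhaps with epsilon-edges;
   peeling off the first step lets closedness yield the edge itself. *)
apply: tr'p; inversion run as [|c a c' t' c'' st run' Ec Et Ec'']; subst.
inversion st as [p0 g b p1 u w u_delta Ep Eb Ec']; subst.
apply: (tr_closed _ _ a p1); exists u; split; last exact: u_delta.
apply/table_fsa_lang.
by have := closed_table_run p1 p tr_closed run' erefl; rewrite cats0.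
Qed.

Lemma empty_separates : (forall t, ~ gpa_lang G t) -> separates popsb.
Proof.
move=> G0; split; first exact: popsb_closed.
by move=> p pF /popsP[t run]; apply: (G0 t); exists p.
Qed.

(** * Numbers as tables, and codes of their automata *)

Definition table T (p : P) (x : option Gamma) (p' : P) :=
  entry #|P| #|Gamma| T (enum_rank p) (letter_code x) (enum_rank p').

Lemma table_surj (tr : P -> option Gamma -> P -> bool) :
  exists2 T, T < 2 ^ (#|P| * #|Gamma|.+1 * #|P|) & table T = tr.
Proof.
have p0 := gpa_init G.
have [T ltT entryT] := entry_surj #|P| #|Gamma| (fun q x q' =>
  tr (nth p0 (enum P) q) (nth None (None :: [seq Some a | a <- enum Gamma]) x)
     (nth p0 (enum P) q')).
exists T => //; do 3!apply: functional_extensionality => ?.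
by rewrite /table entryT ?letter_code_lt // nth_letter_code !nth_enum_rank.
Qed.

Lemma empty_iff_table :
  (forall t, ~ gpa_lang G t) <->
  exists2 T, T < 2 ^ (#|P| * #|Gamma|.+1 * #|P|) & separates (table T).
Proof.
split=> [/empty_separates sep|[T _ /separates_empty//]].
by have [T ltT Tpops] := table_surj popsb; exists T; rewrite ?Tpops.
Qed.

(** Rewrites the code over ranks, in the shape that [FsaE] builds. *)
Lemma table_fsa_code T p1 p' :
  fsa_code (table_fsa (table T) p1 p') =
  CodeSeq.code [:: #|P|;
    CodeSeq.code (mkseq (fun q =>
      CodeSeq.code (mkseq (fun x =>
        CodeSeq.code (mkseq (fun q' =>
          nat_of_bool (entry #|P| #|Gamma| T q x q')) #|P|)) #|Gamma|.+1)) #|P|);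
    nat_of_ord (enum_rank p1);
    CodeSeq.code (mkseq (fun i => nat_of_bool (i == enum_rank p')) #|P|)].
Proof.
rewrite /fsa_code /trans_code /set_code.
congr (CodeSeq.code [:: _; CodeSeq.code _; _; CodeSeq.code _]).
  rewrite -map_enum_rank; apply: eq_map => q.
  apply: (congr1 CodeSeq.code); rewrite -map_letter_code; apply: eq_map => x.
  by apply: (congr1 CodeSeq.code); rewrite -map_enum_rank.
rewrite -map_enum_rank; apply: eq_map => x.
by rewrite in_set1 (inj_eq val_inj) (inj_eq enum_rank_inj).
Qed.

(** Follows from injectivity of the list code; only the lowest [#|P|] digits of [X] matter. *)
Lemma set_code_bits X (F : {set P}) :
  CodeSeq.code (mkseq (fun i => nat_of_bool (bit X i)) #|P|) = set_code F <->
  forall p : P, bit X (enum_rank p) = (p \in F).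
Proof.
rewrite /set_code -map_enum_rank; split=> [/(can_inj CodeSeq.codeK) eqXF p|eqXF].
  have /eq_in_map/(_ p) := eqXF; rewrite mem_enum => /(_ isT).
  by case: (bit _ _); case: (p \in F).
by congr CodeSeq.code; apply: eq_map => p; rewrite eqXF.
Qed.

End Gpa.

(** * The emptiness program *)

(* [FsaE] and [QueryE] run on the arguments
   [p'; p1; a; g; p; T; #|P|; #|Sigma|; #|Gamma|; p0; gamma0; F]. *)
Definition FsaE :=
  ConsE (Proj 6) (ConsE
    (TabE 12 (Proj 6) (TabE 13 (SuccE (Proj 9)) (TabE 14 (Proj 8)
      (EntryE (Proj 8) (Proj 2) (Proj 1) (Proj 0) (Proj 9) (Proj 11)))))
    (ConsE (Proj 1) (ConsE (TabE 12 (Proj 6) (EqE (Proj 0) (Proj 1))) Zero))).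

Definition QueryE :=
  Comp Call [:: Proj 4; Proj 3; Proj 2; Proj 1; FsaE].

(** The loops run over [p], [g], [a], [p1], [p']; each puts its index in front and shifts all
    positions by one. [SuccE (Proj 3)] codes [Some g], as 0 codes epsilon. *)
Definition ClosedE :=
  AllE 7 (Proj 1) (AllE 8 (Proj 4) (AllE 9 (SuccE (Proj 4))
    (AllE 10 (Proj 4) (AllE 11 (Proj 5) (ImpE QueryE
      (EntryE (Proj 5) (Proj 4) (SuccE (Proj 3)) (Proj 0) (Proj 6) (Proj 8))))))).

(* The final states are not decoded from their code: the loop searches for the
   number [X] whose binary digits have that code. *)
Definition AvoidE :=
  AllE 7 (Pow2E (Proj 1)) (ImpE
    (EqE (TabE 8 (Proj 2) (BitE (Proj 1) (Proj 0))) (Proj 7))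
    (AllE 8 (Proj 2) (ImpE (BitE (Proj 1) (Proj 0)) (NotE
      (EntryE (Proj 2) (Proj 6) (SuccE (Proj 7)) (Proj 0) (Proj 3) (Proj 5)))))).

(** Existence of a separating table is searched for as a negated bounded universal; the exponent is
    the number of table entries. *)
Definition EmptyE :=
  NotE (AllE 6 (Pow2E (MulE (MulE (Proj 0) (SuccE (Proj 2))) (Proj 0)))
    (NotE (AndE ClosedE AvoidE))).

(** * Correctness of the program *)

Section Emptiness.
Variables (P Sigma Gamma : finType) (G : gpa P Sigma Gamma) (d : prog).

Lemma decides_query p g a p1 p' T : effective_by G d ->
  decides (computes d) QueryE
    [:: nat_of_ord (enum_rank p'), nat_of_ord (enum_rank p1), letter_code a,
        nat_of_ord (enum_rank g), nat_of_ord (enum_rank p), T & gpa_input G]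
    (exists u, fsa_lang (table_fsa (table T) p1 p') u /\ gpa_delta G p g a p1 u).
Proof.
move=> d_eff; have [b [db bA]] := d_eff p g a p1 (table_fsa (table T) p1 p').
(* [Call] returns the answer of [d]; it remains to check that the argument programs build the
   query. *)
exists b; split=> //; apply: EvalComp (EvalCall db).
do 4!(apply: EvalCons; first by proj); apply: EvalCons (EvalNil _ _).
rewrite table_fsa_code; apply: eval_cons; first by proj.
apply: eval_cons.
  (* The list of holes exposes the number of arguments, so that [size v] reduces to the numeral in
     the program. *)
  apply: (@eval_tab _ _ _ [:: _; _; _; _; _; _; _; _; _; _; _; _]) => [|q _].
    by proj.
  apply: (@eval_tab _ _ _ [:: _; _; _; _; _; _; _; _; _; _; _; _; _]) => [|x _].
    by apply: eval_succ; proj.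
  apply: (@eval_tab _ _ _ [:: _; _; _; _; _; _; _; _; _; _; _; _; _; _]) => [|q' _].
    by proj.
  by apply: eval_entry; proj.
apply: eval_cons; first by proj.
apply: eval_cons; last exact: EvalZero.
apply: (@eval_tab _ _ _ [:: _; _; _; _; _; _; _; _; _; _; _; _]) => [|i _].
  by proj.
by apply: eval_eq; proj.
Qed.

Lemma decides_closed T : effective_by G d ->
  decides (computes d) ClosedE (T :: gpa_input G) (closed_table G (table T)).
Proof.
move=> d_eff.
apply: (@decides_all_fin _ _ _ _ [:: _; _; _; _; _; _; _]) => [|p]; first by proj.
apply: (@decides_all_fin _ _ _ _ [:: _; _; _; _; _; _; _; _]) => [|g]; first by proj.
apply: (@decides_all_letter _ _ _ _ [:: _; _; _; _; _; _; _; _; _]) => [|a].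
  by apply: eval_succ; proj.
apply: (@decides_all_fin _ _ _ _ [:: _; _; _; _; _; _; _; _; _; _]) => [|p1].
  by proj.
apply: (@decides_all_fin _ _ _ _ [:: _; _; _; _; _; _; _; _; _; _; _]) => [|p'].
  by proj.
apply: decides_imp; first exact: decides_query.
apply: (@decides_bool _ _ _ (table T p (Some g) p')) => //.
by apply: eval_entry; first [proj | apply: eval_succ; proj].
Qed.

Lemma decides_avoid T :
  decides (computes d) AvoidE (T :: gpa_input G)
    (forall p, p \in gpa_final G ->
       ~ table T (gpa_init G) (Some (gpa_stack0 G)) p).
Proof.
apply: (decides_iff (A := forall X, X < 2 ^ #|P| ->
  CodeSeq.code (mkseq (fun i => nat_of_bool (bit X i)) #|P|) =
    set_code (gpa_final G) ->
  forall p, bit X (enum_rank p) ->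
  ~ table T (gpa_init G) (Some (gpa_stack0 G)) p)); last first.
  split=> [avoidX p pF|avoid X _ /set_code_bits XF p]; last by rewrite XF => /avoid.
  (* Some [X] below the bound does code the final states, so the guarded statement is not
     vacuous. *)
  have [X ltX XF] := bit_surj #|P| (fun i => nth p (enum P) i \in gpa_final G).
  apply: (avoidX X ltX); last by rewrite XF // nth_enum_rank.
  by apply/set_code_bits => q; rewrite XF // nth_enum_rank.
apply: (@decides_all _ _ _ [:: _; _; _; _; _; _; _]) => [|X _].
  by apply: eval_pow2; proj.
apply: decides_imp.
  apply: decides_eq; last by proj.
  apply: (@eval_tab _ _ _ [:: _; _; _; _; _; _; _; _]) => [|i _]; first by proj.
  by apply: eval_bit; proj.
apply: (@decides_all_fin _ _ _ _ [:: _; _; _; _; _; _; _; _]) => [|p].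
  by proj.
apply: decides_imp.
  by apply: (@decides_bool _ _ _ (bit X (enum_rank p))) => //; apply: eval_bit; proj.
apply: decides_not.
apply: (@decides_bool _ _ _ (table T (gpa_init G) (Some (gpa_stack0 G)) p)) => //.
by apply: eval_entry; first [proj | apply: eval_succ; proj].
Qed.

Lemma decides_empty : effective_by G d ->
  decides (computes d) EmptyE (gpa_input G) (forall t, ~ gpa_lang G t).
Proof.
move=> d_eff; have decT : decides (computes d) EmptyE (gpa_input G)
    (~ forall T, T < 2 ^ (#|P| * #|Gamma|.+1 * #|P|) -> ~ separates G (table T)).
  apply/decides_not/(@decides_all _ _ _ [:: _; _; _; _; _; _]) => [|T _].
    apply: eval_pow2; apply: eval_mul; last by proj.
    by apply: eval_mul; [proj | apply: eval_succ; proj].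
  apply/decides_not/decides_and; [exact: decides_closed | exact: decides_avoid].
apply: (decides_iff decT); rewrite empty_iff_table; split=> [nAll|[T ltT sep] nsep].
  by apply: NNPP => nex; apply: nAll => T ltT sep; apply: nex; exists T.
exact: nsep sep.
Qed.

End Emptiness.

Theorem theorem2p7 :
  exists e : prog,
  forall (P Sigma Gamma : finType) (G : gpa P Sigma Gamma) (d : prog),
    effective_by G d ->
    answers (computes_calling d e) (gpa_input G)
      (forall t : seq Sigma, ~ gpa_lang G t).
Proof. by exists EmptyE => P Sigma Gamma G d; apply: decides_empty. Qed.
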